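(* For any first-order algorithm $\mathcal A$ in the zero-respecting class (defined in the context) that runs for $T$ iterations and any initial point $x_0$, there exists a $(1,1)$-smooth instance of the simple bilevel problem such that the optimal solution $x^*$ satisfies $\|x_0-x^*\|_2\le 1$ and $|f(x_0)-f^*|\ge \frac1{48}$. For the iterates $\{x_k\}_{k=0}^T$ generated by $\mathcal A$, the following holds: $$f(x_k)=f(x_0),\qquad \forall\, 1\le k\le T.$$
   Context: Simple bilevel problem: minimize $f(x)$ over $x\in \mathcal X_g^*:=\arg\min_{z\in\mathcal Z} g(z)$, where $f,g:\mathbb R^n\to\mathbb R$ are convex and continuous and $\mathcal Z\subseteq\mathbb R^n$ is convex and compact. Its optimal value is $f^*$. An instance consists of $n$, $f$, $g$ and $\mathcal Z$ (so the dimension is part of the instance and may depend on $T$). The instance is $(L_f,L_g)$-smooth if $f$ is $L_f$-smooth and $g$ is $L_g$-smooth, where a differentiable real-valued function is $L$-smooth if its gradient is $L$-Lipschitz in the Euclidean norm. For $x\in\mathbb R^n$ write $x_{[j]}$ for its $j$-th coordinate and $\mathrm{supp}(x)=\{j: x_{[j]}\neq 0\}$. Zero-respecting class: an iterative method $\mathcal A$ can access $f$ and $g$ only through a first-order black-box oracle, which takes a test point $\hat x$ as input and returns $\partial f(\hat x),\partial g(\hat x)$, where these symbols denote arbitrary subgradients of $f$ and $g$ at $\hat x$ (the gradients in the differentiable case). $\mathcal A$ generates a sequence of test points $x_0,x_1,x_2,\dots$ with $$\mathrm{supp}(x_{k+1})\subseteq \mathrm{supp}(x_0)\cup\left(\bigcup_{0\le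 s\le k}\mathrm{supp}(\partial f(x_s))\cup\mathrm{supp}(\partial g(x_s))\right).$$ *)

(* Defs.v *)
From mathcomp Require Import all_boot all_order all_algebra.
From mathcomp Require Import all_classical all_reals all_analysis.

Set Implicit Arguments.
Unset Strict Implicit.
Unset Printing Implicit Defensive.

Import Order.TTheory GRing.Theory Num.Theory.
Import numFieldNormedType.Exports.

Local Open Scope classical_set_scope.
Local Open Scope ring_scope.

Section Euclidean.
Context {R : realType} {n : nat}.
Implicit Types (x y s : 'rV[R]_n) (h : 'rV[R]_n -> R).

Definition inner x y : R := \sum_j x 0 j * y 0 j.

(* The norm `|x| of the library is the sup norm on 'rV[R]_n; it induces the
   same topology, but is not the norm of the smoothness and distance bounds. *)
Definition l2norm x : R := Num.sqrt (inner x x).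

Definition supp x : set 'I_n := [set j | x 0 j != 0].

Definition grad h x : 'rV[R]_n := \row_j 'd h x (delta_mx 0 j).

Definition L_smooth (L : R) h : Prop :=
  (forall x, differentiable h x) /\
  (forall x y, l2norm (grad h x - grad h y) <= L * l2norm (x - y)).

Definition is_subgradient h x s : Prop :=
  forall y, h x + inner s (y - x) <= h y.

Definition argmin (D : set 'rV[R]_n) h : set 'rV[R]_n :=
  [set x | D x /\ forall z, D z -> h x <= h z].

End Euclidean.

Record bilevel_problem (R : realType) := BilevelProblem {
  dimension : nat;
  upper : 'rV[R]_dimension -> R;
  lower : 'rV[R]_dimension -> R;
  feasible : set 'rV[R]_dimension;
  upper_convex : convex_function [set: 'rV[R]_dimension] upper;
  upper_continuous : continuous upper;
  lower_convex : convex_function [set: 'rV[R]_dimension] lower;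
  lower_continuous : continuous lower;
  feasible_convex : convex_set feasible;
  feasible_compact : compact feasible
}.

Arguments upper {R} P x : rename.
Arguments lower {R} P x : rename.
Arguments feasible {R} P x : rename.

Section Bilevel.
Context {R : realType}.
Implicit Type P : bilevel_problem R.

Definition lower_solutions P := argmin (feasible P) (lower P).

Definition optimal_solutions P := argmin (@lower_solutions P) (upper P).

Definition optimal_value P : R := inf (upper P @` @lower_solutions P).

Definition smooth_instance (Lf Lg : R) P : Prop :=
  L_smooth Lf (upper P) /\ L_smooth Lg (lower P).

(* The answer at x is (df x, dg x).  Where the objectives are differentiable,
   their subgradients are unique, so the answer there is the pair of
   gradients. *)
Definition first_order_oracle P
    (df dg : 'rV[R]_(dimension P) -> 'rV[R]_(dimension P)) : Prop :=
  forall x, is_subgradient (upper P) x (df x) /\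
            is_subgradient (lower P) x (dg x).

End Bilevel.

Arguments lower_solutions {R} P.
Arguments optimal_solutions {R} P.
Arguments first_order_oracle {R} P df dg.

(* A n Z x0 [:: (u_0, v_0); ...; (u_k, v_k)] is the test point x_(k+1) that the
   method chooses after the oracle has answered (u_s, v_s) at x_s for all
   s <= k.  The objectives are seen only through these answers, while the
   dimension, the feasible set and the initial point are known. *)
Definition first_order_method (R : realType) :=
  forall n : nat, set 'rV[R]_n -> 'rV[R]_n ->
    seq ('rV[R]_n * 'rV[R]_n) -> 'rV[R]_n.

Section Run.
Context {R : realType} (A : first_order_method R) {n : nat}.
Variables (Z : set 'rV[R]_n) (df dg : 'rV[R]_n -> 'rV[R]_n) (x0 : 'rV[R]_n).

Definition test_point (answers : seq ('rV[R]_n * 'rV[R]_n)) : 'rV[R]_n :=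
  if answers is [::] then x0 else A Z x0 answers.

Fixpoint answers (k : nat) : seq ('rV[R]_n * 'rV[R]_n) :=
  if k is k'.+1 then
    let x := test_point (answers k') in rcons (answers k') (df x, dg x)
  else [::].

Definition iterate (k : nat) : 'rV[R]_n := test_point (answers k).

End Run.

Definition zero_respecting (R : realType) (A : first_order_method R) : Prop :=
  forall (P : bilevel_problem R)
    (df dg : 'rV[R]_(dimension P) -> 'rV[R]_(dimension P))
    (x0 : 'rV[R]_(dimension P)),
    first_order_oracle P df dg ->
    let x := iterate A (feasible P) df dg x0 in
    forall k : nat,
      supp (x k.+1) `<=`
        supp x0 `|` \bigcup_(s in [set s | (s <= k)%N])
                      (supp (df (x s)) `|` supp (dg (x s))).

(* Main.v *)
(* The adversary works against an arbitrary deterministic method, because an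
   initial point of full support makes the zero-respecting condition void.
   Put N = 2 (T + 1), c = 1 / sqrt N, and let Z be the Euclidean unit ball around
   x0 in dimension 2 N; Z carries no information about the hard directions.  For
   orthonormal v_0, ..., v_(N-1) and y_j = <v_j, x - x0>, the lower objective is a
   multiple of (y_0 - c)^2 + sum_j (y_(j+1) - y_j)^2 and the upper one a multiple
   of (y_T + ... + y_(N-1))^2.  The zero set {y_0 = ... = y_(N-1) = c} of g is
   tangent to Z, hence meets it in the single point x0 + c sum_j v_j, where f is
   at least 1/16.  Each answer reveals at most one new direction, so v_s can be
   chosen orthogonal to everything seen up to step s; then y_T, ..., y_(N-1)
   vanish at the first T + 1 test points. *)

Require Import Defs.
From HB Require Import structures.
From mathcomp Require Import all_boot all_order all_algebra.
From mathcomp Require Import all_classical all_reals all_analysis.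
From mathcomp Require Import ring lra zify.

Set Implicit Arguments.
Unset Strict Implicit.
Unset Printing Implicit Defensive.

Import Order.TTheory GRing.Theory Num.Theory.
Import numFieldNormedType.Exports.

Local Open Scope classical_set_scope.
Local Open Scope ring_scope.

(** * The Euclidean inner product *)

Section InnerProduct.
Context {R : realType} {n : nat}.
Implicit Types (x y w s : 'rV[R]_n) (m : nat).

Lemma innerC x y : inner x y = inner y x.
Proof. by apply: eq_bigr => j _; rewrite mulrC. Qed.

Fact inner_is_linear w : linear (inner w : 'rV[R]_n -> R^o).
Proof.
move=> k x y; rewrite /inner scaler_sumr -big_split; apply: eq_bigr => j _ /=.
by rewrite !mxE mulrDr; congr (_ + _); rewrite mulrCA.
Qed.

HB.instance Definition _ w :=
  GRing.isLinear.Build R 'rV[R]_n R^o *:%R (inner w) (inner_is_linear w).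

Lemma innerDr w x y : inner w (x + y) = inner w x + inner w y.
Proof. exact: linearD. Qed.

Lemma innerBr w x y : inner w (x - y) = inner w x - inner w y.
Proof. exact: linearB. Qed.

Lemma innerZr w k x : inner w (k *: x) = k * inner w x.
Proof. exact: linearZ. Qed.

Lemma inner0r w : inner w 0 = 0.
Proof. exact: linear0. Qed.

Lemma inner_sumr w (I : Type) (r : seq I) (P : pred I) (F : I -> 'rV[R]_n) :
  inner w (\sum_(i <- r | P i) F i) = \sum_(i <- r | P i) inner w (F i).
Proof. exact: linear_sum. Qed.

Lemma innerDl w x y : inner (x + y) w = inner x w + inner y w.
Proof. by rewrite !(innerC _ w) innerDr. Qed.

Lemma innerBl w x y : inner (x - y) w = inner x w - inner y w.
Proof. by rewrite !(innerC _ w) innerBr. Qed.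

Lemma innerZl w k x : inner (k *: x) w = k * inner x w.
Proof. by rewrite !(innerC _ w) innerZr. Qed.

Lemma inner_suml w (I : Type) (r : seq I) (P : pred I) (F : I -> 'rV[R]_n) :
  inner (\sum_(i <- r | P i) F i) w = \sum_(i <- r | P i) inner (F i) w.
Proof. by rewrite innerC inner_sumr; apply: eq_bigr => i _; rewrite innerC. Qed.

Lemma inner_ge0 x : 0 <= inner x x.
Proof. by apply: sumr_ge0 => j _; rewrite -expr2 sqr_ge0. Qed.

Lemma inner_eq0 x : (inner x x == 0) = (x == 0).
Proof.
apply/eqP/eqP => [x0|->]; last exact: inner0r.
apply/rowP => j; rewrite mxE; apply/eqP; rewrite -sqrf_eq0 expr2; apply/eqP.
by move: x0 j isT; apply: psumr_eq0P => i _; rewrite -expr2 sqr_ge0.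
Qed.

Lemma inner_delta w (j : 'I_n) : inner w (delta_mx 0 j) = w 0 j.
Proof.
rewrite /inner (bigD1 j) //= mxE !eqxx mulr1 big1 ?addr0 // => i ij.
by rewrite mxE eqxx (negPf ij) mulr0.
Qed.

(** The squared length of [inner x x *: y - inner x y *: x] is [inner x x] times the gap between the
    two sides. *)
Lemma cauchy_schwarz x y : inner x y ^+ 2 <= inner x x * inner y y.
Proof.
have [/eqP|x0] := eqVneq (inner x x) 0.
  by rewrite inner_eq0 => /eqP ->; rewrite innerC !inner0r expr0n /= mul0r.
have xp : 0 < inner x x by rewrite lt_neqAle eq_sym x0 inner_ge0.
have := inner_ge0 (inner x x *: y - inner x y *: x).
rewrite !(innerBl, innerBr, innerZl, innerZr) (innerC y x) => h.
rewrite -subr_ge0 -(pmulr_rge0 _ xp); apply: le_trans h _.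
by rewrite le_eqVlt; apply/orP; left; apply/eqP; ring.
Qed.

Lemma l2norm_le1 x : (l2norm x <= 1) = (inner x x <= 1).
Proof. by rewrite /l2norm -{1}sqrtr1 ler_sqrt. Qed.

Lemma inner_continuous w : continuous (inner w : 'rV[R]_n -> R).
Proof.
rewrite /inner; apply: continuous_big.
  exact: (@pseudometric_normed_Zmodule.add_continuous R R^o).
move=> j _ x; apply: continuousM; first exact: cst_continuous.
exact: coord_continuous.
Qed.

(** The matrix [M] with rows [s] has fewer than [n] rows, so [M^T] has a nonzero left kernel, and a
    nonzero vector of it can be normalized. *)
Lemma exists_unit_orthogonal (s : seq 'rV[R]_n) : (size s < n)%N ->
  exists2 u, inner u u = 1 & forall x, x \in s -> inner x u = 0.
Proof.
move=> sn; pose M := \matrix_(i < size s) s`_i.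
have kn0 : kermx M^T != 0.
  rewrite -mxrank_eq0 mxrank_ker -lt0n subn_gt0 mxrank_tr.
  exact: leq_ltn_trans (rank_leq_row M) sn.
pose u := nz_row (kermx M^T); have un0 : u != 0 by rewrite nz_row_eq0.
have uM : u *m M^T = 0 by apply/sub_kermxP; exact: nz_row_sub.
have up : 0 < inner u u by rewrite lt_neqAle eq_sym inner_eq0 un0 inner_ge0.
exists ((Num.sqrt (inner u u))^-1 *: u).
  rewrite innerZl innerZr mulrA -expr2 exprVn sqr_sqrtr ?inner_ge0 //.
  by rewrite mulVf ?gt_eqF.
move=> x xs; rewrite innerZr (_ : inner x u = 0) ?mulr0 //.
have i : (index x s < size s)%N by rewrite index_mem.
have /rowP/(_ (Ordinal i)) := uM; rewrite !mxE => uMi; rewrite -[RHS]uMi innerC.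
by apply: eq_bigr => j _; rewrite !mxE /= nth_index.
Qed.

End InnerProduct.

(** * Sums of squares of affine forms *)

Section SumOfSquares.
Context {R : realType} {n : nat}.
Variables (m : nat) (w : nat -> 'rV[R]_n) (b : nat -> R) (z : 'rV[R]_n).

(** Both objectives have this form: the upper one with a single square, the lower one with one
    square per vector of the chain. *)
Definition sumsq (x : 'rV[R]_n) : R :=
  \sum_(j < m) (inner (w j) (x - z) - b j) ^+ 2.

Definition sumsq_grad (x : 'rV[R]_n) : 'rV[R]_n :=
  2 *: \sum_(j < m) (inner (w j) (x - z) - b j) *: w j.

Lemma inner_sumsq_grad x h : inner (sumsq_grad x) h =
  \sum_(j < m) 2 * (inner (w j) (x - z) - b j) * inner (w j) h.
Proof.
rewrite innerZl inner_suml mulr_sumr; apply: eq_bigr => j _.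
by rewrite innerZl mulrA.
Qed.

Lemma sumsq_expand x y : sumsq y =
  sumsq x + inner (sumsq_grad x) (y - x) +
  \sum_(j < m) inner (w j) (y - x) ^+ 2.
Proof.
rewrite inner_sumsq_grad /sumsq -!big_split; apply: eq_bigr => j _ /=.
rewrite !innerBr; ring.
Qed.

Lemma sumsq_convex : convex_function [set: 'rV[R]_n] sumsq.
Proof.
move=> t x y _ _; rewrite convRE /sumsq /conv /= !mulr_sumr -big_split /=.
have t0 : 0 <= t%:num by [].
have t1 : t%:num <= 1 by [].
apply: ler_sum => j _; set p := t%:num in t0 t1 *.
rewrite !(innerBr, innerDr, innerZr).
rewrite /unstable.onem.
set X := inner _ x; set Y := inner _ y; set Z := inner _ z.
rewrite -subr_ge0.
rewrite [X in 0 <= X](_ : _ = p * (1 - p) * (X - Y) ^+ 2); last by ring.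
by apply: mulr_ge0 (sqr_ge0 _); apply: mulr_ge0; rewrite ?subr_ge0.
Qed.

Lemma is_diff_sumsq x :
  is_diff x (sumsq : 'rV[R]_n -> R^o) (inner (sumsq_grad x)).
Proof.
have -> : inner (sumsq_grad x) = fun h => \sum_(j < m)
    2 * (inner (w j) (x - z) - b j) * inner (w j) h.
  by apply/funext => h; rewrite inner_sumsq_grad.
rewrite /sumsq; elim: m => [|k ih].
  under eq_fun do rewrite big_ord0.
  under [X in is_diff _ _ X]eq_fun do rewrite big_ord0.
  exact: is_diff_cst.
under eq_fun do rewrite big_ord_recr /=.
under [X in is_diff _ _ X]eq_fun do rewrite big_ord_recr /=.
apply: is_diffD.
have lin : is_diff x (inner (w k) : 'rV[R]_n -> R^o) (inner (w k)).
  apply: DiffDef.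
    exact/linear_differentiable/inner_continuous.
  exact/diff_lin/inner_continuous.
have aff : is_diff x
    (fun y => inner (w k) (y - z) - b k : R^o) (inner (w k)).
  rewrite (_ : (fun y => _) =
     inner (w k) - cst (inner (w k) z + b k : R^o)); last first.
    by apply/funext => y; rewrite innerBr /= -addrA -opprD.
  by apply: is_diff_eq; rewrite subr0.
(* The index 1 selects the exponent 2. *)
have := @is_diffX _ _ _ _ 1 _ aff.
by [].
Qed.

Lemma differentiable_sumsq x : differentiable (sumsq : 'rV[R]_n -> R) x.
Proof. by have [] := is_diff_sumsq x. Qed.

Lemma sumsq_continuous : continuous (sumsq : 'rV[R]_n -> R).
Proof.
move=> x; apply: (@differentiable_continuous R 'rV[R]_n R^o).
exact: differentiable_sumsq.
Qed.

Lemma grad_sumsq x : grad sumsq x = sumsq_grad x.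
Proof.
apply/rowP => j; rewrite mxE -[RHS]inner_delta.
by have [_ ->] := is_diff_sumsq x.
Qed.

Hypothesis w_small : \sum_(j < m) inner (w j) (w j) <= 1 / 2.

(** The left side is half the quadratic form of the Hessian, whose trace is at most 1 by [w_small];
    the trace dominates the form by Cauchy-Schwarz. *)
Lemma sumsq_curvature h :
  \sum_(j < m) inner (w j) h ^+ 2 <= 1 / 2 * inner h h.
Proof.
apply: le_trans (ler_wpM2r (inner_ge0 h) w_small).
by rewrite mulr_suml; apply: ler_sum => j _; exact: cauchy_schwarz.
Qed.

(** For the gradient difference [u] at displacement [d], [inner u u] is a sum of products
    [2 * (a * e)], each at most [a ^+ 2 + e ^+ 2]. The curvature bound then gives at most half of
    [inner d d + inner u u]. *)
Lemma sumsq_smooth : L_smooth 1 sumsq.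
Proof.
split=> [x|x y]; first exact: differentiable_sumsq.
rewrite !grad_sumsq mul1r ler_sqrt ?inner_ge0 //.
set d := x - y; set u := sumsq_grad x - sumsq_grad y.
have uu : inner u u = \sum_(j < m) 2 * (inner (w j) d * inner (w j) u).
  rewrite {1}/u innerBl !inner_sumsq_grad -sumrB; apply: eq_bigr => j _.
  by rewrite !innerBr; ring.
have: \sum_(j < m) 2 * (inner (w j) d * inner (w j) u) <=
    \sum_(j < m) inner (w j) d ^+ 2 + \sum_(j < m) inner (w j) u ^+ 2.
  rewrite -big_split; apply: ler_sum => j _ /=.
  set a := inner _ d; set e := inner _ u.
  by have := sqr_ge0 (a - e); rewrite sqrrB -mulr_natl; lra.
move: (sumsq_curvature d) (sumsq_curvature u); rewrite -uu; lra.
Qed.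

(** This forces the oracle's answers. Testing the subgradient inequality at [x + d], with [d] the
    deviation from the gradient, bounds [inner d d] by its own half. *)
Lemma sumsq_subgradient x s : is_subgradient sumsq x s -> s = sumsq_grad x.
Proof.
move=> sub; apply/eqP; rewrite -subr_eq0 -inner_eq0; set d := s - _.
have := sub (d + x); rewrite (sumsq_expand x (d + x)) addrK -addrA lerD2l.
rewrite -lerBlDl -innerBl -/d => /le_trans/(_ (sumsq_curvature d)) dd.
rewrite eq_le inner_ge0 andbT; lra.
Qed.

End SumOfSquares.

(** * Dependence of a run on the oracle *)

Section Run.
Context {R : realType} (A : first_order_method R) {n : nat}.
Variables (Z : set 'rV[R]_n) (x0 : 'rV[R]_n).

(** Serves twice: to lengthen the chain without moving earlier test points, and to replace the upper
    gradient by 0. *)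
Lemma eq_iterate df dg df' dg' k :
  (forall s, (s < k)%N -> let x := iterate A Z df dg x0 s in
    df' x = df x /\ dg' x = dg x) ->
  iterate A Z df' dg' x0 k = iterate A Z df dg x0 k.
Proof.
move=> eq_ans; rewrite /iterate; congr test_point.
elim: k eq_ans => //= k ih eq_ans.
have {ih} e := ih (fun s sk => eq_ans s (leqW sk)).
by rewrite e; case: (eq_ans k (leqnn _)) => -> ->.
Qed.

End Run.

(** * The chain-like lower objective *)

Section Chain.
Context {R : realType} {n : nat}.
Implicit Types (v : nat -> 'rV[R]_n) (N : nat).

Definition orthonormal N v := forall i j, (i < N)%N -> (j < N)%N ->
  inner (v i) (v j) = (i == j)%:R.

Lemma inner_orthonormal_sum N v a j : orthonormal N v -> (a <= j < N)%N ->
  inner (v j) (\sum_(a <= i < N) v i) = 1.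
Proof.
move=> ov jN; have /andP[aj jN'] := jN.
rewrite inner_sumr (eq_big_nat _ _ (F2 := fun i => (i == j)%:R)).
  rewrite (bigD1_seq j) ?iota_uniq ?mem_index_iota //=.
  by rewrite eqxx big1 ?addr0 // => i /negPf ->.
by move=> i /andP[_ iN]; rewrite ov // eq_sym.
Qed.

Lemma inner_orthonormal_sums N v a b : orthonormal N v -> (b <= a <= N)%N ->
  inner (\sum_(a <= i < N) v i) (\sum_(b <= i < N) v i) = (N - a)%:R.
Proof.
move=> ov /andP[ba aN]; rewrite inner_suml.
rewrite (eq_big_nat _ _ (F2 := fun=> 1)) => [|i /andP[ai iN]].
  by rewrite big_const_nat iter_addr addr0.
by rewrite inner_orthonormal_sum // (leq_trans ba ai).
Qed.

(** Index 0 anchors the first coordinate; index [i.+1] links the coordinates [i] and [i.+1], so a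
    link has zero residual while both of them vanish. *)
Definition chain (a : R) v (j : nat) : 'rV[R]_n :=
  a *: (if j is i.+1 then v i.+1 - v i else v 0).

Definition chain_target (a c : R) (j : nat) : R := if j is 0 then a * c else 0.

Lemma chain_small (a : R) N v : orthonormal N v ->
  \sum_(j < N) inner (chain a v j) (chain a v j) <= a ^+ 2 * 2 * N%:R.
Proof.
move=> ov; apply: le_trans (_ : \sum_(j < N) (a ^+ 2 * 2) <= _).
  apply: ler_sum => -[j jN] _; rewrite /chain innerZl innerZr mulrA -expr2.
  apply: ler_wpM2l; first exact: sqr_ge0. case: j jN => [|j] jN /=.
    by rewrite ov // ler1n.
  rewrite !(innerBl, innerBr) !ov ?(ltnW jN) // !eqxx.
  by rewrite (gtn_eqF (ltnSn j)) (ltn_eqF (ltnSn j)) /=; lra.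
by rewrite sumr_const card_ord -[leLHS]mulr_natr.
Qed.

(** All squares vanish: the anchor gives the value [c] and each link passes it on. *)
Lemma chain_eq0 (a c : R) N v (z x : 'rV[R]_n) : a != 0 ->
  sumsq N (chain a v) (chain_target a c) z x = 0 <->
  (forall j, (j < N)%N -> inner (v j) (x - z) = c).
Proof.
move=> a0; split=> [/eqP|vc]; last first.
  rewrite /sumsq big1 // => -[[|j] jN] _ /=; rewrite /chain innerZl.
    by rewrite vc // subrr expr0n.
  by rewrite innerBl (vc _ jN) (vc _ (ltnW jN)) subrr mulr0 subr0 expr0n.
rewrite psumr_eq0 => [/allP res0|j _]; last exact: sqr_ge0.
have res j : (j < N)%N -> inner (chain a v j) (x - z) = chain_target a c j.
  move=> jN; have /= := res0 (Ordinal jN); rewrite mem_index_enum sqrf_eq0.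
  by move=> /(_ isT)/eqP/subr0_eq.
elim=> [|j ih] jN; have := res _ jN; rewrite /chain innerZl /=.
  exact: mulfI.
move/eqP; rewrite mulf_eq0 (negPf a0) innerBl subr_eq0 => /eqP ->.
by apply: ih; exact: ltnW.
Qed.

End Chain.

(** * Adaptive choice of the hidden directions *)

Section Resisting.
Context {R : realType} (A : first_order_method R) {n : nat}.
Variables (Z : set 'rV[R]_n) (x0 : 'rV[R]_n) (a c : R).

(** The upper answers are set to 0, so that the run depends on the chain alone; the true upper
    gradient vanishes at the points concerned. *)
Let run N v := iterate A Z (fun=> 0)
  (sumsq_grad N (chain a v) (chain_target a c) x0) x0.

(* At s < N the run only depends on v 0, ..., v (s - 1): its first s points have
   vanishing coordinates along every later vector.  So v N may be chosen after
   the points 0, ..., N of the run are known. *)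
Lemma resisting_chain N : (N.*2 <= n)%N ->
  exists2 v, orthonormal N v &
    forall s j, (s <= j < N)%N -> inner (v j) (run N v s - x0) = 0.
Proof.
elim: N => [_|N ih Nn].
  by exists (fun=> 0) => // s j; rewrite ltn0 andbF.
have [|v ov v0] := ih; first by apply: leq_trans Nn; rewrite leq_double.
(* These are [N] directions and [N.+1] displacements, [2N + 1] vectors in all, hence the dimension
   bound [N.+1.*2]. *)
pose past := map v (iota 0 N) ++ [seq run N v s - x0 | s <- iota 0 N.+1].
have [|u uu pastu] := @exists_unit_orthogonal R n past.
  rewrite size_cat !size_map !size_iota addnS addnn.
  by apply: leq_trans Nn; rewrite doubleS.
have vu j : (j < N)%N -> inner (v j) u = 0.
  move=> jN; apply: pastu; rewrite mem_cat; apply/orP; left.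
  by apply: map_f; rewrite mem_iota.
have ru s : (s <= N)%N -> inner u (run N v s - x0) = 0.
  move=> sN; rewrite innerC; apply: pastu; rewrite mem_cat; apply/orP; right.
  by apply: (map_f (fun s => run N v s - x0)); rewrite mem_iota.
pose v' j := if j == N then u else v j.
have v'N : v' N = u by rewrite /v' eqxx.
have v'v j : (j < N)%N -> v' j = v j by move=> jN; rewrite /v' ltn_eqF.
(* The new direction only adds the link of index [N] to the lower gradient. At a point [s < N] its
   residual is 0: the displacement is orthogonal to [u] by choice and to [v N.-1] by induction. *)
have runE k : (k <= N)%N -> run N.+1 v' k = run N v k.
  move=> kN; apply: eq_iterate => s sk /=; split=> //.
  have sN := leq_trans sk kN.
  have N0 : (0 < N)%N := leq_ltn_trans (leq0n s) sN.
  have xu := ru s (ltnW sN).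
  have xv : inner (v N.-1) (run N v s - x0) = 0.
    by apply: v0; rewrite ltn_predL N0 -ltnS prednK // sN.
  rewrite -/(run N v s); move: (run N v s) xu xv => x xu xv.
  have lastE : inner (chain a v' N) (x - x0) - chain_target a c N = 0.
    have -> : chain a v' N = a *: (u - v N.-1).
      by rewrite -v'N -(v'v N.-1) ?prednK //; case: (N) N0.
    have -> : chain_target a c N = 0 by case: (N) N0.
    by rewrite innerZl innerBl xu xv subrr mulr0 subr0.
  congr (2 *: _); rewrite big_ord_recr /= lastE scale0r addr0.
  have cE j : (j < N)%N -> chain a v' j = chain a v j.
    by case: j => [|j] jN; rewrite /chain !v'v // ltnW.
  by apply: eq_bigr => j _; rewrite cE.
exists v' => [i j|s j].
  rewrite !ltnS (leq_eqVlt i) (leq_eqVlt j) => /predU1P[->|iN] /predU1P[->|jN].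
  - by rewrite v'N uu eqxx.
  - by rewrite v'N v'v // innerC vu // gtn_eqF.
  - by rewrite v'N v'v // vu // ltn_eqF.
  - by rewrite !v'v // ov.
rewrite ltnS => /andP[sj jN].
rewrite runE ?(leq_trans sj) //.
have [->|jN'] := eqVneq j N; first by rewrite v'N ru // (leq_trans sj).
have jN2 : (j < N)%N by rewrite ltn_neqAle jN'.
by rewrite v'v // v0 // sj.
Qed.

End Resisting.

(** * The Euclidean unit ball as feasible set *)

Section UnitBall.
Context {R : realType} {n : nat}.
Implicit Types (x y z : 'rV[R]_n).

Definition unit_ball z : set 'rV[R]_n := [set x | inner (x - z) (x - z) <= 1].

(** A convex combination of [u] and [w] loses exactly [p * (1 - p) * inner (u - w) (u - w)] in
    squared length. *)
Lemma unit_ball_convex z : convex_set (unit_ball z).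
Proof.
have conv_ball (p : R) x y : 0 <= p -> p <= 1 -> unit_ball z x ->
    unit_ball z y -> unit_ball z (p *: x + (1 - p) *: y).
  rewrite /unit_ball /= => p0 p1.
  have -> : p *: x + (1 - p) *: y - z = p *: (x - z) + (1 - p) *: (y - z).
    by apply/rowP => j; rewrite !mxE; ring.
  move: (x - z) (y - z) => u w xz yz.
  have d0 := inner_ge0 (u - w).
  have q1 : 0 <= 1 - p by rewrite subr_ge0.
  have q0 := mulr_ge0 p0 q1.
  have := mulr_ge0 q0 d0; rewrite !(innerBl, innerBr, innerDl, innerDr).
  rewrite !(innerZl, innerZr) (innerC w u) => pd.
  have := ler_wpM2l p0 xz; have := ler_wpM2l q1 yz; lra.
move=> x y t /set_mem xz /set_mem yz; apply/mem_set.
exact: conv_ball xz yz.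
Qed.

Lemma continuous_coordB z j : continuous (fun x : 'rV[R]_n => (x - z) 0 j).
Proof.
rewrite (_ : (fun x => _) = fun x => x 0 j - z 0 j).
  move=> x; apply: continuousB; last exact: cst_continuous.
  exact: coord_continuous.
by apply/funext => x; rewrite !mxE.
Qed.

Lemma unit_ball_compact z : compact (unit_ball z).
Proof.
apply: bounded_closed_compact.
  (* The sup norm is at most the Euclidean one, since one squared coordinate is at most the sum of
     all. *)
  exists (`|z| + 1); split; first exact: num_real.
  move=> M zM x xz; rewrite -(subrK z x); apply: le_trans (ler_normD _ _) _.
  apply: le_trans (ltW zM); rewrite addrC lerD2l [leLHS]/Num.norm /= mx_normrE.
  apply/bigmax_leP; split=> //= -[i j] _ /=.
  rewrite (ord1 i) -(@ler_pXn2r _ 2) ?nnegrE // expr1n real_normK ?num_real //.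
  apply: le_trans xz; rewrite /inner (bigD1 j) //= expr2 lerDl.
  by apply: sumr_ge0 => k _; rewrite -expr2 sqr_ge0.
apply: (@closed_comp _ _ (fun x => inner (x - z) (x - z)) [set r | r <= 1]).
  move=> x _; rewrite /inner; apply: continuous_big.
    exact: (@pseudometric_normed_Zmodule.add_continuous R R^o).
  move=> j _ y; apply: continuousM; apply: continuous_coordB.
exact: closed_le.
Qed.

End UnitBall.

(** * The hard instance *)

Theorem theorem4p1 (R : realType) (T : nat) (A : first_order_method R)
    (HA : zero_respecting A) (x0 : forall n : nat, 'rV[R]_n) :
  exists P : bilevel_problem R,
    [/\ smooth_instance 1 1 P,
        exists xstar : 'rV[R]_(dimension P),
          optimal_solutions P = [set xstar] /\
          l2norm (x0 (dimension P) - xstar) <= 1,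
        1 / 48%:R <= `|upper P (x0 (dimension P)) - optimal_value P|
      & forall df dg : 'rV[R]_(dimension P) -> 'rV[R]_(dimension P),
          first_order_oracle P df dg ->
          forall k : nat, (1 <= k <= T)%N ->
            upper P (iterate A (feasible P) df dg (x0 (dimension P)) k)
              = upper P (x0 (dimension P))].
Proof.
pose N := T.+1.*2; pose z := x0 N.*2.
(* The value of [c] gives [p] below unit length; [a] is the scale at which [a ^+ 2 * 2 * N%:R]
   equals 1/2, the bound for smoothness. *)
pose c : R := (Num.sqrt N%:R)^-1; pose a := c / 2.
have TN : (T <= N)%N by rewrite /N -addnn (leq_trans (leqnSn T)) ?leq_addr.
have cN : c ^+ 2 * N%:R = 1.
  by rewrite exprVn sqr_sqrtr // mulVf // pnatr_eq0.
have a0 : a != 0.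
  by rewrite mulf_neq0 ?invr_eq0 ?gt_eqF // sqrtr_gt0 ltr0n.
have [v ov vrun] := @resisting_chain R A N.*2 (unit_ball z) z a c N (leqnn _).
(* The sum may start at [T] because [vrun] includes the case [s = j]. *)
pose w := a *: \sum_(T <= j < N) v j.
have f_small : \sum_(j < 1) inner w w <= 1 / 2.
  rewrite big_ord1 innerZl innerZr inner_orthonormal_sums ?leqnn //.
  have : (N - T)%:R <= N%:R :> R by rewrite ler_nat leq_subr.
  move=> /(ler_wpM2l (sqr_ge0 c)); rewrite cN /a; lra.
have g_small : \sum_(j < N) inner (chain a v j) (chain a v j) <= 1 / 2.
  apply: le_trans (chain_small a ov) _; move: cN; rewrite /a; lra.
pose f := sumsq 1 (fun=> w) (fun=> 0) z.
pose g := sumsq N (chain a v) (chain_target a c) z.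
pose P := @BilevelProblem R N.*2 f g (unit_ball z)
  (@sumsq_convex _ _ _ _ _ _) (@sumsq_continuous _ _ _ _ _ _)
  (@sumsq_convex _ _ _ _ _ _) (@sumsq_continuous _ _ _ _ _ _)
  (@unit_ball_convex _ _ z) (@unit_ball_compact _ _ z).
pose p := c *: \sum_(0 <= j < N) v j.
have pp : inner p p = 1.
  by rewrite innerZl innerZr inner_orthonormal_sums // subn0 mulrA -expr2.
have solP : lower_solutions P = [set z + p].
  have gzp : g (z + p) = 0.
    apply/(chain_eq0 _ _ _ _ _ a0) => j jN.
    by rewrite [z + p]addrC addrK innerZr inner_orthonormal_sum ?mulr1.
  have g0 x : 0 <= g x by apply: sumr_ge0 => j _; exact: sqr_ge0.
  have zpB : unit_ball z (z + p).
    by rewrite /unit_ball /= [z + p]addrC addrK pp.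
  apply/seteqP; split=> x /=.
    move=> [xB /(_ _ zpB) xmin]; have gx : g x <= 0 by rewrite -gzp.
    have /(chain_eq0 _ _ _ _ _ a0) vx : g x = 0.
      by apply/eqP; rewrite eq_le gx g0.
    have px : inner p (x - z) = 1.
      rewrite innerZl inner_suml.
      rewrite (eq_big_nat _ _ (F2 := fun=> c)) => [|j /andP[_ jN]].
        rewrite big_const_nat iter_addr addr0 subn0 -mulr_natr mulrA -expr2.
        exact: cN.
      exact: vx.
    (* Tangency: the squared length is at most 1 - 2 + 1 = 0. *)
    have : inner (x - z - p) (x - z - p) == 0.
      have dd : inner (x - z) (x - z) <= 1 := xB.
      move: (x - z) dd px => d dd pd.
      rewrite eq_le inner_ge0 andbT !(innerBl, innerBr) (innerC d p) pd pp.
      lra.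
    by rewrite inner_eq0 subr_eq0 subr_eq addrC => /eqP.
  by move=> ->; split=> // y _; rewrite [lower P (z + p)]gzp; exact: g0.
have optP : optimal_solutions P = [set z + p].
  apply/seteqP; split=> x /=; rewrite /optimal_solutions /argmin /= solP.
    by case.
  by move=> ->; split=> // _ ->.
have fz x : inner w (x - z) = 0 -> f x = 0.
  by move=> wx; rewrite /f /sumsq big_ord1 wx subr0 expr0n.
exists P; split.
- by split; exact: sumsq_smooth.
- exists (z + p); split=> //; rewrite l2norm_le1 -/z.
  by rewrite opprD addrA subrr add0r -scaleN1r innerZl innerZr pp; lra.
- rewrite /optimal_value solP image_set1 inf1.
  rewrite -[upper P _]/(f z) -[upper P (z + p)]/(f (z + p)).
  rewrite fz ?subrr ?inner0r // sub0r normrN /f /sumsq big_ord1 subr0.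
  rewrite [z + p]addrC addrK innerZl innerZr inner_orthonormal_sums //.
  rewrite ger0_norm ?sqr_ge0 //.
  have NT : N%:R <= 2 * (N - T)%:R :> R.
    by rewrite -natrM ler_nat mulnBr leq_subRL /N; lia.
  have := ler_wpM2l (sqr_ge0 c) NT; rewrite cN.
  (* With [y = c ^+ 2 * (2 * (N - T)%:R) >= 1], the gap is [(y / 4) ^+ 2], at least 1/16. *)
  have -> : a * (c * (N - T)%:R) = c ^+ 2 * (2 * (N - T)%:R) / 4.
    by rewrite /a; field.
  move: (c ^+ 2 * _) => y y1; nra.
- move=> df dg ora k /andP[_ kT].
  have dfE x : df x = sumsq_grad 1 (fun=> w) (fun=> 0) z x.
    by apply: sumsq_subgradient => //; have [] := ora x.
  have dgE x : dg x = sumsq_grad N (chain a v) (chain_target a c) z x.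
    by apply: sumsq_subgradient => //; have [] := ora x.
  have wrun s : (s <= T)%N -> inner w (iterate A (unit_ball z) (fun=> 0)
      (sumsq_grad N (chain a v) (chain_target a c) z) z s - z) = 0.
    move=> sT; rewrite innerZl inner_suml big_nat_cond big1 ?mulr0 // => j.
    by move=> /andP[/andP[Tj jN] _]; apply: vrun; rewrite (leq_trans sT).
  rewrite -[RHS]/(f z) -[LHS]/(f _) [RHS]fz ?subrr ?inner0r //.
  (* At the points before [k] the upper gradient is a multiple of [inner w (x - z) = 0], so the true
     run coincides with the one of [vrun]. *)
  rewrite (eq_iterate (df := fun=> 0)
    (dg := sumsq_grad N (chain a v) (chain_target a c) z)).
    exact/fz/wrun.
  move=> s sk /=; rewrite dfE dgE; split=> //.
  rewrite /sumsq_grad big_ord1 wrun ?subr0 ?scale0r ?scaler0 //.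
  exact: ltnW (leq_trans sk kT).
Qed.
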